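(* Let $N:\Delta_\star\to\{0,1,2,\ldots\}$ be a function with finite support which is not identically zero, and let $\ell\ge 1$ be the number of distinct $\delta'\in\Delta_\star$ with $N(\delta')\neq 0$. Then the number of unimodal permutations $\delta\in\Delta(\star)$ whose cycle-counter $N_\delta$ equals $N$ is exactly $2^{\ell-1}$.
   Context: Let $I_n=\{1,2,\ldots,n\}$ for $n\ge 1$. A permutation $\delta$ of $I_n$ is unimodal if there is $m\in I_n$ such that $a<b\le m$ implies $\delta(a)<\delta(b)$, and $m\le a<b$ implies $\delta(a)>\delta(b)$ (so $m=\delta^{-1}(n)$). $\Delta(n)$ is the set of unimodal permutations of $I_n$, and $\Delta(\star)=\bigcup_{n\ge1}\Delta(n)$. $\Delta_n\subset\Delta(n)$ is the set of those that are transitive, i.e. consist of a single $n$-cycle, and $\Delta_\star=\bigcup_{n\ge1}\Delta_n$ (with $\Delta_1$ consisting of the identity on $I_1$). For a finite set $J\subset\mathbb{R}$ with $\|J\|=k$ elements, $\Omega_J:I_k\to J$ is the unique increasing bijection. If $\delta\in\Delta(n)$ and $J\subseteq I_n$ is the underlying set of one of the disjoint cycles of $\delta$ (fixed points count as cycles of length 1), then the shape of the cycle $\delta|_J$ is $\Omega_J^{-1}\circ\delta\circ\Omega_J\in\Delta_{\|J\|}$. The cycle-counter $N_\delta:\Delta_\star\to\{0,1,2,\ldots\}$ of $\delta\in\Delta(\star)$ is defined by letting $N_\delta(\delta')$ be the number of cycles of $\delta$ with shape $\delta'$. *)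

(* Defs.v *)
From HB Require Import structures.
From mathcomp Require Import all_boot all_fingroup.
From mathcomp Require Import finmap.

Set Implicit Arguments.
Unset Strict Implicit.
Unset Printing Implicit Defensive.

(* The index set {1, ..., n} is represented by 'I_n = {0, ..., n - 1}. The
   existential over the peak m rules out n = 0. *)
Definition unimodal (n : nat) (d : 'S_n) : bool :=
  [exists m : 'I_n, [forall a : 'I_n, [forall b : 'I_n,
    ((a < b <= m) ==> (d a < d b)) && ((m <= a < b) ==> (d b < d a))]]].

Definition transitive_perm (n : nat) (d : 'S_n) : bool := #|porbits d| == 1.

Definition Delta : Type := {d : {n : nat & 'S_n} | unimodal (tagged d)}.

Definition cyclicDelta : Type :=
  {d : {n : nat & 'S_n} | unimodal (tagged d) && transitive_perm (tagged d)}.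

(* As [enum J] lists J in increasing order, [enum_val : 'I_#|J| -> 'I_n] is the
   increasing bijection from 'I_#|J| onto J, and [enum_rank_in _] is its inverse
   on J. [restr_perm J d] agrees with d on J as soon as d stabilizes J, which
   holds for every cycle J of d; it is used instead of d so that the definition
   makes sense without a side condition on J. *)
Definition cycle_shape_fun (n : nat) (d : 'S_n) (J : {set 'I_n}) (i : 'I_#|J|) :
    'I_#|J| :=
  enum_rank_in (enum_valP i) (restr_perm J d (enum_val i)).

Lemma cycle_shape_inj (n : nat) (d : 'S_n) (J : {set 'I_n}) :
  injective (@cycle_shape_fun n d J).
Proof.
have inJ (i : 'I_#|J|) : restr_perm J d (enum_val i) \in J.
  by rewrite (perm_closed _ (restr_perm_on J d)) enum_valP.
move=> i j /(congr1 (@enum_val _ _)).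
by rewrite !enum_rankK_in // => /perm_inj /enum_val_inj.
Qed.

Definition cycle_shape (n : nat) (d : 'S_n) (J : {set 'I_n}) : 'S_#|J| :=
  perm (@cycle_shape_inj n d J).

(* Permutations of possibly different degrees are compared in the sigma type
   {n & 'S_n}. Fixed points are the singletons of [porbits]. *)
Definition cycle_counter (d : Delta) (c : cyclicDelta) : nat :=
  let s := tagged (val d) in
  #|[set J in porbits s |
      Tagged (fun n : nat => 'S_n) (cycle_shape s J) == val c]|.

(* Main.v *)
Require Import Defs.
From HB Require Import structures.
From mathcomp Require Import all_boot all_fingroup.
From mathcomp Require Import finmap zify.

Set Implicit Arguments.
Unset Strict Implicit.
Unset Printing Implicit Defensive.

(** A unimodal permutation d of degree n can be cut at two places k such that d
    increases on [0, k) and decreases on [k, n), since the peak may be put on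
    either side; the two values of n - k have opposite parities. Recording on
    which side of the cut the successive iterates of i lie gives a monotone
    semiconjugacy H from d to a fixed discrete tent map. The sizes of the fibers
    of H are constant along tent orbits and determine (d, k), and every
    tent-invariant family of fiber sizes occurs. A cycle with an odd number of
    points beyond the cut reverses the order of the fibers it meets; hence it
    meets each fiber at most once, and no two such cycles of d have the same
    shape. If it shares a fiber with a cyclic unimodal permutation whose cut is
    even, the latter meets that fiber an even number of times. Therefore the
    fiber sizes modulo 2 tell which shapes occur with an odd cut, and then how
    often each shape occurs with an even one. So the pairs (d, parity of n - k)
    with cycle counter N correspond to the subsets of the support of N (the
    shapes with one copy cut oddly), and there are two such pairs for each d. *)

(** * Initial segments of ordinals and increasing enumerations *)

Lemma card_ord_ltn n k : k <= n -> #|[set i : 'I_n | i < k]| = k.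
Proof.
move=> le_kn; rewrite -sum1dep_card -(big_ord_widen_cond n xpredT (fun=> 1)) //.
by rewrite sum1_card card_ord.
Qed.

(** A downward closed set is an initial segment; this turns cardinalities into thresholds. *)
Lemma ltn_card_downset n (P : {set 'I_n}) :
  (forall i j : 'I_n, i <= j -> j \in P -> i \in P) ->
  forall i : 'I_n, (i < #|P|) = (i \in P).
Proof.
move=> downP i; apply/idP/idP => [lt_iP|Pi].
  apply: contraLR lt_iP => nPi; rewrite -leqNgt -[leqRHS](card_ord_ltn (ltnW (ltn_ord i))).
  apply/subset_leq_card/subsetP => j Pj; rewrite inE ltnNge.
  by apply: contra nPi => le_ij; apply: downP Pj.
rewrite -[X in X <= _](card_ord_ltn (ltn_ord i)).
by apply/subset_leq_card/subsetP => j; rewrite inE ltnS => /downP; apply.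
Qed.

Lemma enum_val_ltn n (A : {set 'I_n}) (i j : 'I_#|A|) :
  i < j -> enum_val i < enum_val j.
Proof.
move=> lt_ij.
have srt : sorted (relpre val ltn) (enum A).
  rewrite /(enum A) sorted_filter //; first by move=> x y z; apply: ltn_trans.
  by rewrite -enumT -sorted_map val_enum_ord iota_ltn_sorted.
have x0 := enum_val i; rewrite !(enum_val_nth x0).
apply: (sorted_ltn_nth _ x0 srt); rewrite ?inE -?cardE ?ltn_ord //.
by move=> x y z; apply: ltn_trans.
Qed.

(** * Cuts and codings by the tent map *)

(** Nothing compares the values at k - 1 and k, so the peak may lie on either side of the cut, and k
    may be 0 or n. *)
Definition bimonotone n (d : 'S_n) (k : nat) : bool :=
  [forall a : 'I_n, forall b : 'I_n, (a < b) ==>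
    ((b < k) ==> (d a < d b)) && ((k <= a) ==> (d b < d a))].

Lemma bimonotoneP n (d : 'S_n) k :
  reflect (forall a b : 'I_n, a < b -> (b < k -> d a < d b) /\ (k <= a -> d b < d a))
          (bimonotone d k).
Proof.
apply: (iffP forallP) => [bim a b lt_ab | bim a].
  by have /forallP/(_ b)/implyP/(_ lt_ab)/andP[/implyP ? /implyP ?] := bim a.
apply/forallP => b; apply/implyP => /bim[inc dec].
by apply/andP; split; apply/implyP.
Qed.

(* The tent map on {0, ..., 2m - 1}: the decreasing branch is v |-> 4m - 1 - 2v
   (the odd value keeps it injective). *)
Definition tent m v := if v < m then v.*2 else (m.*2 - v).*2.-1.

Lemma tent_inj m v w : v < m.*2 -> w < m.*2 -> tent m v = tent m w -> v = w.
Proof. by rewrite /tent; case: (ltnP v m) => ?; case: (ltnP w m) => ?; lia. Qed.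

Lemma tent_lt m v : v < m.*2 -> tent m v < m.*2.
Proof. by rewrite /tent; case: (ltnP v m) => ?; lia. Qed.

Definition coding m n (d : 'S_n) k (H : 'I_n -> nat) : Prop :=
  forall i, [/\ H i < m.*2, (H i < m) = (i < k) & H (d i) = tent m (H i)].

Lemma coding_iter m n (d : 'S_n) k H : coding m d k H ->
  forall t i, H (iter t d i) = iter t (tent m) (H i).
Proof. by move=> cod; elim=> //= t IHt i; have [_ _ ->] := cod (iter t d i); rewrite IHt. Qed.

(** Both codings put a point on the same side of m, so each step doubles their difference. As it
    stays below 2m < 2^(2m), it is zero. *)
Lemma coding_unique m n (d : 'S_n) k H H' :
  coding m d k H -> coding m d k H' -> H =1 H'.
Proof.
(* Truncated subtraction in both directions gives the absolute difference. *)
move=> cod cod'; pose D i := (H i - H' i) + (H' i - H i).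
have DS i : D (d i) = (D i).*2.
  rewrite /D; have [? e1 ->] := cod i; have [? e2 ->] := cod' i.
  by rewrite /tent e1 e2; move: e1 e2; case: (i < k) => ? ?; lia.
have Dt t i : D (iter t d i) = 2 ^ t * D i.
  by elim: t => [|t IHt] /=; rewrite ?mul1n // DS IHt expnS -mul2n mulnA.
move=> i; have := Dt m.*2 i; have := ltn_expl m.*2 (isT : 1 < 2).
have [? _ _] := cod (iter m.*2 d i); have [? _ _] := cod' (iter m.*2 d i).
have {1}-> : D (iter m.*2 d i) = (H (iter m.*2 d i) - H' (iter m.*2 d i)) +
  (H' (iter m.*2 d i) - H (iter m.*2 d i)) by [].
case: (posnP (D i)) => [|D0]; first by rewrite /D; lia.
by move: (2 ^ _) => X; nia.
Qed.

Lemma coding_mono m n (d : 'S_n) k H : bimonotone d k -> coding m d k H ->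
  forall i j : 'I_n, i <= j -> H i <= H j.
Proof.
move=> /bimonotoneP bim cod.
(* An inversion of H would double under d forever. *)
have gap t (i j : 'I_n) : i < j -> 2 ^ t * (H i - H j) < m.*2.
  elim: t i j => [|t IHt] i j lt_ij; first by have [? _ _] := cod i; lia.
  have [inc dec] := bim _ _ lt_ij.
  have [? li ei] := cod i; have [? lj ej] := cod j.
  have [//|lt_H] := leqP (H i) (H j); first by move=> /eqP ->; lia.
  have [lt_ik|le_ki] := ltnP i k.
    have lt_jk : j < k by lia.
    by have := IHt _ _ (inc lt_jk); rewrite ei ej /tent li lj lt_ik lt_jk expnS; nia.
  have lt_jk : (j < k) = false by lia.
  have lt_ik : (i < k) = false by lia.
  have := IHt _ _ (dec le_ki); rewrite ei ej /tent li lj lt_ik lt_jk expnS.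
  suff -> : (m.*2 - H j).*2.-1 - (m.*2 - H i).*2.-1 = 2 * (H i - H j) by lia.
  by lia.
move=> i j; rewrite leq_eqVlt => /predU1P[/val_inj -> //|/(gap m.*2)].
have := ltn_expl m.*2 (isT : 1 < 2); move: (2 ^ _) => X ? ?.
by rewrite leqNgt; apply/negP => ?; nia.
Qed.

(** * Itineraries and the existence of codings *)

(** Parity of the visits beyond the cut during t steps from i, hence whether these steps reverse the
    order of points with a common itinerary; [vpar] reads it off the tent orbit of a code. *)
Fixpoint par n (d : 'S_n) k t (i : 'I_n) : bool :=
  if t is t'.+1 then (k <= i) (+) par d k t' (d i) else false.

Fixpoint vpar m t v : bool :=
  if t is t'.+1 then (m <= v) (+) vpar m t' (tent m v) else false.

Lemma parD n (d : 'S_n) k s t i :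
  par d k (s + t) i = par d k s i (+) par d k t (iter s d i).
Proof. by elim: s i => //= s IHs i; rewrite IHs addbA -iterSr. Qed.

(* The t-bit number whose bits are the running parities of the number of visits
   beyond the cut, so that the usual order is the order of tent itineraries. *)
Fixpoint itin n (d : 'S_n) k t (i : 'I_n) : nat :=
  if t is t'.+1 then
    if i < k then itin d k t' (d i) else 2 ^ t - 1 - itin d k t' (d i)
  else 0.

Lemma itin_lt n (d : 'S_n) k t i : itin d k t i < 2 ^ t.
Proof.
elim: t i => //= t IHt i; rewrite expnS.
by have := IHt (d i); case: ifP => _; lia.
Qed.

(** [itin] recurses on the first step, while this appends the last one as lowest bit. The two agree
    because complementing a number flips each of its bits. *)
Lemma itinS n (d : 'S_n) k t i :
  itin d k t.+1 i = (itin d k t i).*2 + par d k t.+1 i.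
Proof.
elim: t i => [|t IHt] i; first by rewrite /=; case: (ltnP i k).
rewrite -[LHS]/(if i < k then itin d k t.+1 (d i) else 2 ^ t.+2 - 1 - itin d k t.+1 (d i)).
rewrite -[par _ _ _ _]/((k <= i) (+) par d k t.+1 (d i)) IHt.
rewrite /= -/(par d k t.+1 (d i)); have := itin_lt d k t (d i); rewrite !expnS (leqNgt k).
case: (i < k) => /=; first by case: (_ (+) _); lia.
by case: (_ (+) _) => /=; lia.
Qed.

(* All permutations of degree at most q satisfy d^(q!) = 1, so that P = 2 * q! is
   a common period along which every orbit passes beyond the cut an even number
   of times; P - 1 bits of the itinerary then suffice, and 2 * scale = 2^(P-1). *)
Definition scale q := 2 ^ (2 * q`! - 2).
Definition code q n (d : 'S_n) k i := itin d k (2 * q`! - 1) i.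

Lemma iter_fact n (d : 'S_n) q i : n <= q -> iter q`! d i = i.
Proof.
move=> le_nq; rewrite -permX.
have/dvdnP[u ->] : #[d]%g %| q`!.
  rewrite (fact_split le_nq) dvdn_mulr //.
  have := @cardSg _ [set: 'S_n]%G <[d]>%G (subsetT _).
  by rewrite cardsT card_Sn.
by rewrite mulnC expgM expg_order expg1n perm1.
Qed.

(** The itinerary over the full period has last bit 0, so it is twice the code of i; unfolding its
    first step expresses it through the code of [d i]. Equating the two gives the tent map. *)
Lemma code_coding q n (d : 'S_n) k : n <= q -> coding (scale q) d k (code q d k).
Proof.
move=> le_nq i; have q0 := fact_gt0 q.
have e1 : 2 * q`! - 1 = (2 * q`! - 2).+1 by lia.
have e2 : (scale q).*2 = 2 ^ (2 * q`! - 1) by rewrite e1 expnS mul2n.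
(* The orbit closes up after q! steps, so the second half repeats the visits of the first. *)
have pP j : par d k (2 * q`!) j = false.
  by rewrite mul2n -addnn parD iter_fact // addbb.
have itP j : itin d k (2 * q`!) j = (code q d k j).*2.
  have e : 2 * q`! = (2 * q`! - 1).+1 by lia.
  by rewrite {1}e itinS -e pP addn0.
have lk : (code q d k i < scale q) = (i < k).
  rewrite /code e1 /=; have := itin_lt d k (2 * q`! - 2) (d i).
  rewrite expnS -/(scale q); move: (itin _ _ _ _) (scale q) => x s.
  by case: (i < k) => ?; lia.
split=> //; first by rewrite e2 itin_lt.
have := itP i; have e : 2 * q`! = (2 * q`! - 1).+1 by lia.
rewrite {1}e /= -/(code q d k (d i)) -/(code q d k i) /tent lk.
have := itin_lt d k (2 * q`! - 1) (d i); rewrite -/(code q d k (d i)).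
have := itin_lt d k (2 * q`! - 1) (i); rewrite -/(code q d k i).
by rewrite expnS -e2; case: (i < k) => //; lia.
Qed.

(** * Order and returns within the fibers of a coding *)

Section Coding.
Variables (m n : nat) (d : 'S_n) (k : nat) (H : 'I_n -> nat).
Hypotheses (bim : bimonotone d k) (cod : coding m d k H).

(** Points of one fiber stay in a common fiber, hence on the same side of the cut, and each step
    beyond the cut reverses their order. *)
Lemma fiber_order x y t : H x = H y -> x < y ->
  if vpar m t (H x) then iter t d y < iter t d x else iter t d x < iter t d y.
Proof.
elim: t x y => [|t IHt] x y eH lt_xy //.
have [_ lx ex] := cod x; have [_ ly ey] := cod y.
have [inc dec] := bimonotoneP _ _ bim _ _ lt_xy.
have eHd : H (d x) = H (d y) by rewrite ex ey eH.
rewrite !iterSr -[vpar _ _ _]/((m <= H x) (+) vpar m t (tent m (H x))) -ex leqNgt lx.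
case: (ltnP x k) => [lt_xk|le_kx] /=.
  by apply: IHt => //; apply: inc; rewrite -ly -eH lx.
by have := IHt _ _ (esym eHd) (dec le_kx); rewrite eHd; case: vpar.
Qed.

(** An order-reversing return cannot fix two distinct points of the fiber. *)
Lemma odd_return_unique x y t : H x = H y -> vpar m t (H x) ->
  iter t d x = x -> iter t d y = y -> x = y.
Proof.
move=> eH podd ex ey; have podd' : vpar m t (H y) by rewrite -eH.
case: (ltngtP x y) => [lt_xy|lt_yx|/val_inj //].
  by have := fiber_order t eH lt_xy; rewrite podd ex ey; lia.
by have := fiber_order t (esym eH) lt_yx; rewrite podd' ex ey; lia.
Qed.

(** If an order-preserving return moved x, repeating it would give an infinite strictly monotone
    sequence in a finite set. *)
Lemma even_return x t : H (iter t d x) = H x -> ~~ vpar m t (H x) ->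
  iter t d x = x.
Proof.
move=> eH peven; pose z s := iter s (iter t d) x.
have eHz s : H (z s) = H x.
  elim: s => //= s IHs; rewrite /z /= -/(z s) (coding_iter cod) IHs.
  by rewrite -(coding_iter cod).
case: (ltngtP x (iter t d x)) => [lt|lt|/val_inj //].
  have mon s : z s < z s.+1.
    elim: s => //= s IHs.
    have := fiber_order t (etrans (eHz s) (esym (eHz s.+1))) IHs.
    by rewrite eHz (negPf peven).
  have: n <= z n.
    by elim: {1 3}n => // s IHs; apply: leq_ltn_trans IHs (mon s).
  by rewrite leqNgt ltn_ord.
have mon s : z s.+1 < z s.
  elim: s => //= s IHs.
  have := fiber_order t (etrans (eHz s.+1) (esym (eHz s))) IHs.
  by rewrite eHz (negPf peven).
have: z n + n <= x.
  elim: {2 3}n => [|s IHs]; first by rewrite addn0.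
  by have := mon s; lia.
by have := ltn_ord x; lia.
Qed.

Lemma coding_le : k <= n -> k = #|[set i | H i < m]|.
Proof.
move=> le_kn; rewrite -[LHS](card_ord_ltn le_kn).
by apply: eq_card => i; rewrite !inE; have [_ -> _] := cod i.
Qed.

Lemma coding_ge : k <= n -> n - k = #|[set i | m <= H i]|.
Proof.
move=> le_kn; rewrite -[n in LHS]card_ord (coding_le le_kn).
rewrite -(cardsC [set i | H i < m]) addnC addnK.
by apply: eq_card => i; rewrite !inE -leqNgt.
Qed.

(** Injectivity of the tent map makes d a bijection between the two fibers. *)
Lemma card_fiber_tent v : v < m.*2 ->
  #|[set i | H i == tent m v]| = #|[set i | H i == v]|.
Proof.
move=> lt_v; rewrite -(card_preimset _ (@perm_inj _ d)).
apply: eq_card => i; rewrite !inE; have [lt_i _ ->] := cod i.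
by apply/eqP/eqP => [/tent_inj -> //|->].
Qed.

End Coding.

(** * Fiber sizes as complete invariants of permutations with a cut *)

Lemma card_fiber_lt m n (H : 'I_n -> nat) (P : pred nat) : (forall i, H i < m) ->
  #|[set i | P (H i)]| = \sum_(v < m | P v) #|[set i | H i == v]|.
Proof.
move=> ltH; rewrite -sum1dep_card.
rewrite (partition_big (fun i => Ordinal (ltH i)) (fun v : 'I_m => P v)) //=.
apply: eq_bigr => v Pv; rewrite -sum1dep_card; apply: eq_bigl => i.
by rewrite -val_eqE /=; case: eqP => [->|]; rewrite ?Pv ?andbF.
Qed.

(** Each value of a permutation is the number of smaller values, so the order of the values
    determines it. *)
Lemma homo_perm_eq n (d d' : 'S_n) :
  (forall i j, d i < d j -> d' i < d' j) -> d = d'.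
Proof.
move=> homo; apply/permP => i; apply: val_inj.
have rk (f : 'S_n) j : #|[set i | f i < f j]| = f j.
  rewrite -[RHS](card_ord_ltn (ltnW (ltn_ord (f j)))).
  by rewrite -[RHS](card_preimset _ (@perm_inj _ f)); apply: eq_card => x; rewrite !inE.
have homo' u v : d' u < d' v -> d u < d v.
  case: (ltngtP (d u) (d v)) => // [/homo|/val_inj/perm_inj ->]; lia.
rewrite /= -(rk d) -(rk d'); apply: eq_card => j; rewrite !inE.
by apply/idP/idP => [/homo|/homo'].
Qed.

(** Codings are monotone, so fiber sizes determine them, and k counts the codes below m. The order
    of [d i] and [d j] follows from their codes if these differ; otherwise i and j share a fiber,
    and the side of the cut decides. *)
Lemma fiber_count_inj m n (d d' : 'S_n) k k' H H' : k <= n -> k' <= n ->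
  bimonotone d k -> bimonotone d' k' -> coding m d k H -> coding m d' k' H' ->
  (forall v, #|[set i | H i == v]| = #|[set i | H' i == v]|) ->
  d = d' /\ k = k'.
Proof.
move=> le_kn le_kn' bim bim' cod cod' eqc.
have ltH i : H i < m.*2 by have [] := cod i.
have ltH' i : H' i < m.*2 by have [] := cod' i.
have eq_lt v i : (H i < v) = (H' i < v).
  have eqC : #|[set i | H i < v]| = #|[set i | H' i < v]|.
    rewrite (card_fiber_lt (ltn^~ v) ltH) (card_fiber_lt (ltn^~ v) ltH').
    by apply: eq_bigr => w _; rewrite eqc.
  have := @ltn_card_downset n [set i | H i < v] _ i; rewrite eqC inE => <-.
    have := @ltn_card_downset n [set i | H' i < v] _ i; rewrite inE => -> // x y le_xy.
    by rewrite !inE; apply: leq_ltn_trans (coding_mono bim' cod' le_xy).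
  by move=> x y le_xy; rewrite !inE; apply: leq_ltn_trans (coding_mono bim cod le_xy).
have eqH i : H' i = H i.
  by have := eq_lt (H i) i; have := eq_lt (H' i) i; rewrite !ltnn; lia.
split; last first.
  rewrite (coding_le cod le_kn) (coding_le cod' le_kn').
  by apply: eq_card => i; rewrite !inE eqH.
apply: homo_perm_eq => i j lt_ij.
have [_ li ei] := cod i; have [_ lj ej] := cod j.
have [_ li' ei'] := cod' i; have [_ lj' ej'] := cod' j.
have := coding_mono bim cod (ltnW lt_ij); rewrite leq_eqVlt => /predU1P[eq_H|lt_H]; last first.
  rewrite ltnNge; apply/negP => /(coding_mono bim' cod').
  by rewrite ei' ej' !eqH -ei -ej leqNgt lt_H.
have eqHij : H i = H j by move: eq_H; rewrite ei ej => /tent_inj ->.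
have kk (x : 'I_n) : (x < k) = (x < k') by have [_ <- _] := cod x; have [_ <- _] := cod' x; rewrite eqH.
case: (ltngtP i j) => [lt|lt|/val_inj eq]; last by rewrite eq ltnn in lt_ij.
  have [inc dec] := bimonotoneP _ _ bim _ _ lt.
  have [inc' dec'] := bimonotoneP _ _ bim' _ _ lt.
  have [lt_k|le_k] := ltnP i k; last by have := dec le_k; lia.
  by apply: inc'; rewrite -kk -lj -eqHij li.
have [inc dec] := bimonotoneP _ _ bim _ _ lt.
have [inc' dec'] := bimonotoneP _ _ bim' _ _ lt.
have [lt_k|le_k] := ltnP j k.
  by have := inc; rewrite -li eqHij lj lt_k => /(_ isT); lia.
by apply: dec'; rewrite leqNgt -kk -leqNgt.
Qed.

(** Put r v points over v and map them onto those over [tent m v], keeping their order for v < m and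
    reversing it otherwise. Invariance of r makes the sizes match. *)
Lemma fiber_count_surj m r : (forall v, v < m.*2 -> r (tent m v) = r v) ->
  exists n (d : 'S_n) k H, [/\ k <= n, bimonotone d k, coding m d k H &
    forall v, v < m.*2 -> #|[set i | H i == v]| = r v].
Proof.
(* The base is positive and exceeds every fiber size, so division by B recovers the fiber and the
   position in it. *)
move=> rT; pose B := (\max_(v < m.*2) r v).+1.
have ltB v : v < m.*2 -> r v < B.
  by move=> lt_v; rewrite ltnS (leq_bigmax (Ordinal lt_v)).
(* The a-th point of the fiber over v is encoded as w = v * B + a. *)
pose A := [set w : 'I_(m.*2 * B) | w %% B < r (w %/ B)].
pose b w := if w %/ B < m then w %% B else (r (w %/ B)).-1 - w %% B.
pose g w := tent m (w %/ B) * B + b w.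
have ltd (w : 'I_(m.*2 * B)) : w %/ B < m.*2 by rewrite ltn_divLR.
have ltb (w : 'I_(m.*2 * B)) : w \in A -> b w < r (w %/ B).
  by rewrite inE /b; case: ifP => _ ?; lia.
have ltbB (w : 'I_(m.*2 * B)) : w \in A -> b w < B.
  by move=> /ltb lt; apply: ltn_trans lt (ltB _ (ltd w)).
have gdiv (w : 'I_(m.*2 * B)) : w \in A -> g w %/ B = tent m (w %/ B).
  by move=> wA; rewrite /g divnMDl // (divn_small (ltbB _ wA)) addn0.
have gmod (w : 'I_(m.*2 * B)) : w \in A -> g w %% B = b w.
  by move=> wA; rewrite /g modnMDl (modn_small (ltbB _ wA)).
have ltg (w : 'I_(m.*2 * B)) : w \in A -> g w < m.*2 * B.
  by move=> wA; rewrite -ltn_divLR // gdiv // tent_lt.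
pose e (i : 'I_#|A|) := enum_val i.
have eA i : e i \in A := enum_valP i.
(* The default of [insubd] is never taken, by [ltg]. *)
pose f i := enum_rank_in (eA i) (insubd (e i) (g (e i))).
have ef i : e (f i) = g (e i) :> nat.
  have eg : val (insubd (e i) (g (e i))) = g (e i) by rewrite insubdK //; apply: ltg.
  rewrite /e enum_rankK_in ?eg // inE eg gmod // gdiv // rT // ltb //.
have injf : injective f.
  move=> i j eqf; have := ef i; rewrite eqf ef => eqg.
  have := congr1 (divn^~ B) eqg; rewrite !gdiv // => /tent_inj eqd.
  have {}eqd : e j %/ B = e i %/ B by apply: eqd.
  have := congr1 (modn^~ B) eqg; rewrite !gmod // /b eqd.
  have := eA i; have := eA j; rewrite !inE eqd => lti ltj eqm.
  apply/enum_val_inj/val_inj; rewrite /= -/(e i) -/(e j).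
  rewrite (divn_eq (e i) B) (divn_eq (e j) B) eqd; congr (_ + _).
  by move: eqm; case: ifP => _; lia.
pose H i := e i %/ B.
have monH (i j : 'I_#|A|) : i <= j -> H i <= H j.
  rewrite leq_eqVlt => /predU1P[/val_inj -> //|/enum_val_ltn lt].
  by rewrite /H leq_div2r // ltnW.
pose K := [set i : 'I_#|A| | H i < m].
have kP (i : 'I_#|A|) : (i < #|K|) = (H i < m).
  have := @ltn_card_downset _ K _ i; rewrite inE => -> // x y le_xy.
  by rewrite !inE; apply: leq_ltn_trans (monH _ _ le_xy).
exists #|A|, (perm injf), #|K|, H; split.
- by rewrite -[leqRHS]card_ord max_card.
- apply/bimonotoneP => i j lt_ij; rewrite !permE.
    have emono (x y : 'I_#|A|) : x < y -> e x < e y by apply: enum_val_ltn.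
  have lte : e i < e j by apply: emono.
  have gmono x y : g (e x) < g (e y) -> f x < f y.
    rewrite -!ef; case: (ltngtP (f x) (f y)) => // [/emono|/val_inj ->]; lia.
  have lei : H i <= H j by apply/monH/ltnW.
  have mdi := divn_eq (e i) B; have mdj := divn_eq (e j) B.
  have := eA i; have := eA j; rewrite !inE -/(H i) -/(H j) => lti ltj.
  have bi := ltbB _ (eA i); have bj := ltbB _ (eA j).
  have li := ltd (e i); have lj := ltd (e j).
  have [eqd|ned] := eqVneq (H i) (H j).
    have ltm : e i %% B < e j %% B by move: lte mdi mdj; rewrite -/(H i) -/(H j) eqd; lia.
    split=> [|le_k]; first rewrite kP => lt_jm; apply: gmono; rewrite /g /b -/(H i) -/(H j) eqd.
      by rewrite lt_jm ltn_add2l.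
    have -> : (H j < m) = false by rewrite -eqd -kP ltnNge le_k.
    by rewrite ltn_add2l; move: lti ltj; rewrite eqd; lia.
  have {}ned : H i < H j by rewrite ltn_neqAle ned.
  have lex x y : tent m (H x) < tent m (H y) -> g (e x) < g (e y).
    by move=> lt; rewrite ltnNge; apply: contraL lt => /(leq_div2r B); rewrite !gdiv // leqNgt.
  split=> [|le_k]; first rewrite kP => lt_jm; apply/gmono/lex.
    by rewrite /tent lt_jm (ltn_trans ned) //; lia.
  have le_m : m <= H i by rewrite leqNgt -kP -leqNgt.
  by move: li lj; rewrite /tent -/(H i) -/(H j) !ltnNge le_m (leq_trans le_m lei) /=; lia.
- by move=> i; split; [exact: ltd | rewrite kP | rewrite permE /H ef gdiv].
move=> v lt_v.
have lt_va (a : 'I_(r v)) : v * B + a < m.*2 * B.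
  by rewrite -ltn_divLR // divnMDl // divn_small ?addn0 // (ltn_trans (ltn_ord a)) ?ltB.
pose h (a : 'I_(r v)) := Ordinal (lt_va a).
have ha (a : 'I_(r v)) : a < B := ltn_trans (ltn_ord a) (ltB _ lt_v).
have hA a : h a \in A by rewrite inE /= modnMDl divnMDl // divn_small // addn0 modn_small.
have injh : injective h by move=> x y /(congr1 val) /= /addnI /val_inj.
rewrite -[RHS]card_ord -(card_imset _ injh) -(card_imset _ enum_val_inj).
apply: eq_card => w; apply/imsetP/imsetP => [[i]|[a _ ->]].
  rewrite inE => /eqP eqv ->; have := eA i; rewrite inE -/(H i) eqv => lt_a.
  exists (Ordinal lt_a) => //; apply: val_inj => /=.
  by rewrite {1}(divn_eq (enum_val i) B) -/(e i) -/(H i) eqv.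
exists (enum_rank_in (hA a) (h a)); last by rewrite enum_rankK_in.
by rewrite inE /H /e enum_rankK_in //= divnMDl // divn_small ?addn0.
Qed.

(** * Cycles and their shapes *)

Lemma porbits_perm n (d : 'S_n) J x : J \in porbits d -> x \in J -> d x \in J.
Proof.
by case/imsetP=> y _ -> /porbitP[i ->]; rewrite -permM -expgSr mem_porbit.
Qed.

Lemma cycle_shapeE n (d : 'S_n) J : J \in porbits d ->
  forall i, enum_val (cycle_shape d J i) = d (enum_val i).
Proof.
move=> Jd i; rewrite /cycle_shape permE /cycle_shape_fun.
have eJ := enum_valP i; have dJ := porbits_perm Jd eJ.
have Nd : d \in ('N(J | 'P))%g.
  by rewrite inE in_setT inE /=; apply/subsetP => y yJ; rewrite inE /= (porbits_perm Jd).
by rewrite restr_permE // enum_rankK_in.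
Qed.

Lemma transitive_permP n (d : 'S_n) :
  reflect (0 < n /\ forall i j, j \in porbit d i) (transitive_perm d).
Proof.
apply: (iffP idP) => [/cards1P[J eJ]|[n_gt0 tr]].
  have eqJ i : porbit d i = J by apply/set1P; rewrite -eJ imset_f.
  split=> [|i j]; last by rewrite (eqJ i) -(eqJ j) porbit_id.
  have /imsetP[i _ _] : J \in porbits d by rewrite eJ set11.
  exact: leq_ltn_trans (ltn_ord i).
apply/cards1P; exists (porbit d (Ordinal n_gt0)); apply/setP => J; rewrite !inE.
apply/imsetP/eqP => [[i _ ->]|->]; last by exists (Ordinal n_gt0).
by apply/eqP; rewrite eq_porbit_mem tr.
Qed.

Section Restriction.
Variables (n p : nat) (d : 'S_n) (c : 'S_p) (e : 'I_p -> 'I_n) (k kc : nat).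
Hypothesis e_mono : forall i j : 'I_p, i < j -> e i < e j.
Hypothesis e_morph : forall i, e (c i) = d (e i).
Hypothesis e_cut : forall i : 'I_p, (i < kc) = (e i < k).

Lemma restriction_iter t i : e (iter t c i) = iter t d (e i).
Proof. by elim: t => //= t <-. Qed.

Lemma restriction_bimonotone : bimonotone d k -> bimonotone c kc.
Proof.
move=> /bimonotoneP bim; apply/bimonotoneP => a b lt_ab.
have e_mono' x y : e x < e y -> x < y.
  by case: (ltngtP x y) => // [/e_mono|/val_inj ->]; lia.
have [inc dec] := bim _ _ (e_mono lt_ab).
split=> [|]; first by rewrite e_cut => /inc; rewrite -!e_morph; apply: e_mono'.
by rewrite leqNgt e_cut -leqNgt => /dec; rewrite -!e_morph; apply: e_mono'.
Qed.

Lemma restriction_coding m H : coding m d k H -> coding m c kc (H \o e).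
Proof. by move=> cod i; have [? ? ?] := cod (e i); split; rewrite /= ?e_cut ?e_morph. Qed.

End Restriction.

(** The cut that the shape of J inherits from a cut k of the whole permutation. *)
Definition cut n k (J : {set 'I_n}) := #|[set i in J | i < k]|.

Lemma cut_le n k (J : {set 'I_n}) : cut k J <= #|J|.
Proof. by apply/subset_leq_card/subsetP => i; rewrite inE => /andP[]. Qed.

Lemma ltn_cut n k (J : {set 'I_n}) (i : 'I_#|J|) : (i < cut k J) = (enum_val i < k).
Proof.
pose P := [set i : 'I_#|J| | enum_val i < k].
have -> : cut k J = #|P|.
  rewrite -(card_imset _ enum_val_inj); apply: eq_card => x; rewrite inE.
  apply/andP/imsetP => [[xJ ltx]|[j]].
    by exists (enum_rank_in xJ x); rewrite ?inE enum_rankK_in.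
  by rewrite inE => ltj ->; rewrite enum_valP.
rewrite (ltn_card_downset (P := P)) ?inE // => x y; rewrite !inE leq_eqVlt.
by case/predU1P=> [/val_inj -> //|/enum_val_ltn]; apply: ltn_trans.
Qed.

Section Shape.
Variables (n : nat) (d : 'S_n) (J : {set 'I_n}).
Hypothesis Jd : J \in porbits d.

Lemma shape_bimonotone k : bimonotone d k -> bimonotone (cycle_shape d J) (cut k J).
Proof.
exact: restriction_bimonotone (@enum_val_ltn _ J) (cycle_shapeE Jd) (@ltn_cut _ k J).
Qed.

Lemma shape_coding m k H : coding m d k H ->
  coding m (cycle_shape d J) (cut k J) (H \o enum_val).
Proof. exact: restriction_coding (cycle_shapeE Jd) (@ltn_cut _ k J) _ _. Qed.

Lemma shape_transitive : transitive_perm (cycle_shape d J).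
Proof.
apply/transitive_permP; split=> [|i j].
  by case/imsetP: Jd => x _ eJ; apply/card_gt0P; exists x; rewrite eJ porbit_id.
have /porbitP[t et] : enum_val j \in porbit d (enum_val i).
  case/imsetP: Jd => x _ eJ; have := enum_valP i; have := enum_valP j.
  by rewrite {2 4}eJ -!eq_porbit_mem => /eqP -> /eqP ->.
apply/porbitP; exists t; apply: enum_val_inj.
by rewrite et !permX (restriction_iter (cycle_shapeE Jd)).
Qed.

End Shape.

(** * Codings of transitive permutations *)

Section Cyclic.
Variables (m n : nat) (d : 'S_n) (k : nat) (H : 'I_n -> nat).
Hypotheses (le_kn : k <= n) (tr : transitive_perm d).
Hypotheses (bim : bimonotone d k) (cod : coding m d k H).

Lemma porbit_transitive x : porbit d x = setT.
Proof. by have /transitive_permP[_ tr'] := tr; apply/setP => y; rewrite tr' inE. Qed.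

Lemma card_porbit_transitive x : #|porbit d x| = n.
Proof. by rewrite porbit_transitive cardsT card_ord. Qed.

Lemma card_traject (P : pred 'I_n) x : #|[set i | P i]| = count P (traject d x n).
Proof.
have := uniq_traject_porbit d x; rewrite card_porbit_transitive => Ut.
rewrite cardE -size_filter; apply/perm_size/uniq_perm; rewrite ?enum_uniq ?filter_uniq //.
move=> y; rewrite mem_enum inE mem_filter -[n in traject d x n](card_porbit_transitive x).
by rewrite -porbit_traject porbit_transitive inE andbT.
Qed.

Lemma iter_transitive x : iter n d x = x.
Proof. by have := iter_porbit d x; rewrite card_porbit_transitive. Qed.

Lemma return_time_ge x t : 0 < t -> iter t d x = x -> n <= t.
Proof.
move=> t_gt0 ret; rewrite leqNgt; apply/negP => lt_tn.
have := uniq_traject_porbit d x; rewrite card_porbit_transitive => Ut.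
have := @nth_uniq _ x (traject d x n) 0 t; rewrite size_traject => /(_ _ lt_tn Ut).
rewrite (ltn_trans t_gt0) // !nth_traject ?(ltn_trans t_gt0) // ret eqxx => /(_ isT).
by case: t t_gt0 {ret lt_tn}.
Qed.

(** The n steps visit every point once, and n - k points lie beyond the cut. *)
Lemma vpar_transitive x : vpar m n (H x) = odd (n - k).
Proof.
have parE t y : vpar m t (H y) = odd (count (fun z => m <= H z) (traject d y t)).
  elim: t y => //= t IHt y; have [_ _ <-] := cod y.
  by rewrite IHt oddD; case: leqP.
by rewrite parE -card_traject -(coding_ge cod).
Qed.

(** Here n steps fix every point but reverse the order of each fiber. *)
Lemma odd_fiber_inj x y : odd (n - k) -> H x = H y -> x = y.
Proof.
move=> odd_nk eH; apply: (odd_return_unique bim cod eH (t := n)).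
- by rewrite vpar_transitive.
- exact: iter_transitive.
exact: iter_transitive.
Qed.

Lemma transitive_return x t : H (iter t d x) = H x -> vpar m t (H x) = odd (n - k) ->
  iter t d x = x.
Proof.
have [odd_nk|even_nk] := boolP (odd (n - k)); first by move=> eH _; apply: odd_fiber_inj.
by move=> eH par0; apply: (even_return bim cod); rewrite ?par0.
Qed.

(** Thus one code and the degree determine all fiber sizes. *)
Lemma card_fiber_traject x v :
  #|[set i | H i == v]| = count_mem v (traject (tent m) (H x) n).
Proof.
have countE t y : count (fun i => H i == v) (traject d y t) =
    count_mem v (traject (tent m) (H y) t).
  by elim: t y => //= t IHt y; have [_ _ <-] := cod y; rewrite IHt.
by rewrite (card_traject (fun i => H i == v) x) countE.
Qed.

Lemma fiber_tent_iter x y : exists t, H y = iter t (tent m) (H x).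
Proof.
have /porbitP[t ->] : y \in porbit d x by rewrite porbit_transitive inE.
by exists t; rewrite permX (coding_iter cod).
Qed.

End Cyclic.

(** * Two transitive permutations sharing a code *)

Section TwoCycles.
Variables (m n n' : nat) (d : 'S_n) (d' : 'S_n') (k k' : nat).
Variables (H : 'I_n -> nat) (H' : 'I_n' -> nat).
Hypotheses (le_kn : k <= n) (le_kn' : k' <= n').
Hypotheses (tr : transitive_perm d) (tr' : transitive_perm d').
Hypotheses (bim : bimonotone d k) (bim' : bimonotone d' k').
Hypotheses (cod : coding m d k H) (cod' : coding m d' k' H').

(** After n' steps the common code recurs, with the parity that forces x itself to return. *)
Lemma cyclic_size_le x x' : odd (n - k) = odd (n' - k') -> H x = H' x' -> n <= n'.
Proof.
move=> eq_odd eH; have n'_gt0 : 0 < n' := leq_ltn_trans (leq0n x') (ltn_ord x').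
apply: (return_time_ge tr n'_gt0 (x := x)); apply: (transitive_return le_kn tr bim cod).
  by rewrite (coding_iter cod) eH -(coding_iter cod') iter_transitive.
by rewrite eH eq_odd (vpar_transitive le_kn' tr' cod').
Qed.

(** The codes of d' lie on the tent orbit of [H x], where the fibers of H are single points and
    those of H' all have r points. Hence n' - k' = r (n - k), which is even with n - k odd. *)
Lemma even_cyclic_fiber x x' : odd (n - k) -> ~~ odd (n' - k') -> H x = H' x' ->
  ~~ odd #|[set i | H' i == H x]|.
Proof.
move=> odd_nk even_nk' eH; set r := #|_|.
have ltH i : H i < m.*2 by have [] := cod i.
have ltH' i : H' i < m.*2 by have [] := cod' i.
have constr t : #|[set i | H' i == iter t (tent m) (H x)]| = r.
  elim: t => //= t <-; apply: (card_fiber_tent cod').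
  by rewrite -(coding_iter cod).
have fiberE u : #|[set i | H' i == u]| = r * #|[set i | H i == u]|.
  case: (pickP (fun i => H i == u)) => [y /eqP <-|H0].
    have -> : [set i | H i == H y] = [set y].
      apply/setP => z; rewrite !inE; apply/eqP/eqP => [|-> //].
      by move/(odd_fiber_inj le_kn tr bim cod odd_nk).
    by have [t ->] := fiber_tent_iter tr cod x y; rewrite constr cards1 muln1.
  rewrite [X in _ * X]eq_card0 ?muln0 => [|y]; last by rewrite inE H0.
  apply: eq_card0 => y'; rewrite inE; apply/negbTE/eqP => eu.
  have [t] := fiber_tent_iter tr' cod' x' y'; rewrite eu -eH -(coding_iter cod).
  by move/esym/eqP; rewrite H0.
move: even_nk'; rewrite (coding_ge cod' le_kn') (card_fiber_lt (leq m) ltH').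
under eq_bigr do rewrite fiberE.
by rewrite -big_distrr -(card_fiber_lt (leq m) ltH) -(coding_ge cod le_kn) oddM odd_nk andbT.
Qed.

End TwoCycles.

(** The degrees agree by [cyclic_size_le] used both ways; then so do all fiber sizes, read off the
    tent orbit of the shared code. *)
Lemma cyclic_fiber_eq m n n' (d : 'S_n) (d' : 'S_n') k k' H H' x x' :
    k <= n -> k' <= n' -> transitive_perm d -> transitive_perm d' ->
    bimonotone d k -> bimonotone d' k' -> coding m d k H -> coding m d' k' H' ->
    odd (n - k) = odd (n' - k') -> H x = H' x' ->
  Tagged (fun n => 'S_n) d = Tagged (fun n => 'S_n) d'.
Proof.
move=> le_kn le_kn' tr tr' bim bim' cod cod' eq_odd eH.
have le_n := cyclic_size_le le_kn le_kn' tr tr' bim cod cod' eq_odd eH.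
have le_n' := cyclic_size_le le_kn' le_kn tr' tr bim' cod' cod (esym eq_odd) (esym eH).
have eq_n : n = n' by apply/eqP; rewrite eqn_leq le_n.
case: _ / eq_n d' k' H' x' {le_n le_n'} => d' k' H' x' in le_kn' tr' bim' cod' eq_odd eH *.
have [|-> //] := fiber_count_inj le_kn le_kn' bim bim' cod cod'.
move=> v; rewrite (card_fiber_traject tr cod x) (card_fiber_traject tr' cod' x').
by rewrite eH.
Qed.

(** * The two cuts of a unimodal permutation *)

(** The cut with parity eps of n - k; [unimodal_mark] shows that the default is not taken for
    unimodal d. *)
Definition mark n (d : 'S_n) (eps : bool) : nat :=
  odflt ord0 [pick k : 'I_n.+1 | bimonotone d k && (odd (n - k) == eps)].

(** Distinct cuts of equal parity differ by at least two; with k the smaller, d would both increase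
    and decrease from k to k + 1. *)
Lemma bimonotone_unique n (d : 'S_n) k k' : k <= n -> k' <= n ->
  bimonotone d k -> bimonotone d k' -> odd (n - k) = odd (n - k') -> k = k'.
Proof.
wlog lt_kk' : k k' / k < k'.
  move=> wl le_kn le_kn' bim bim' eq_odd; case: (ltngtP k k') => // lt.
    exact: wl.
  by apply/esym/wl.
move=> le_kn le_kn' /bimonotoneP bim /bimonotoneP bim' eq_odd.
have lt1 : k.+1 < k' by lia.
have lt2 : k.+1 < n by lia.
have [_ dec] := bim (Ordinal (ltnW lt2)) (Ordinal lt2) (leqnn _).
have [inc _] := bim' (Ordinal (ltnW lt2)) (Ordinal lt2) (leqnn _).
by have := dec (leqnn _); have := inc lt1; lia.
Qed.

Lemma mark_unique n (d : 'S_n) k : bimonotone d k -> k <= n -> mark d (odd (n - k)) = k.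
Proof.
move=> bim le_kn; rewrite /mark; case: pickP => [k' /andP[bim' /eqP eq_odd]|].
  by apply: (bimonotone_unique _ le_kn bim' bim eq_odd); rewrite leq_ord.
by move/(_ (Ordinal (le_kn : k < n.+1))); rewrite /= bim eqxx.
Qed.

(** If p is the peak, p and p + 1 are both cuts, of opposite parities. *)
Lemma unimodal_mark n (d : 'S_n) eps : unimodal d ->
  [/\ mark d eps <= n, bimonotone d (mark d eps) & odd (n - mark d eps) = eps].
Proof.
case/existsP=> p /forallP uni.
have inc (a b : 'I_n) : a < b -> b <= p -> d a < d b.
  move=> lt_ab le_bp; have /forallP/(_ b)/andP[/implyP] := uni a.
  by rewrite lt_ab le_bp => ->.
have dec (a b : 'I_n) : p <= a -> a < b -> d b < d a.
  move=> le_pa lt_ab; have /forallP/(_ b)/andP[_ /implyP] := uni a.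
  by rewrite lt_ab le_pa => ->.
suff [k] : exists k, [/\ k <= n, bimonotone d k & odd (n - k) = eps].
  by case=> le_kn bim <-; rewrite mark_unique.
have lt_pn := ltn_ord p.
have [eq_odd|neq_odd] := eqVneq (odd (n - p)) eps.
  exists p; split=> //; first exact: ltnW.
  apply/bimonotoneP => a b lt_ab; split=> [lt_bp|le_pa]; last exact: dec.
  by apply: inc => //; apply: ltnW.
exists p.+1; split=> //; last by move: neq_odd; rewrite -(subnSK lt_pn) /=; case: odd; case: eps.
by apply/bimonotoneP => a b lt_ab; split=> [lt_bp|le_pa]; [apply: inc | apply: dec => //; apply: ltnW].
Qed.

(** The peak is whichever of k - 1 and k exists and has the larger value. *)
Lemma bimonotone_unimodal n (d : 'S_n) k : 0 < n -> k <= n -> bimonotone d k -> unimodal d.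
Proof.
move=> n_gt0 le_kn /bimonotoneP bim.
have uniP (p : 'I_n) : (forall a b : 'I_n, a < b -> b <= p -> d a < d b) ->
    (forall a b : 'I_n, p <= a -> a < b -> d b < d a) -> unimodal d.
  move=> inc dec; apply/existsP; exists p; apply/forallP => a; apply/forallP => b.
  by apply/andP; split; apply/implyP => /andP[? ?]; [apply: inc | apply: dec].
case: (posnP k) bim => [->|k_gt0] bim.
  apply: (uniP (Ordinal n_gt0)) => a b; first by move=> ? /=; lia.
  by move=> _ /bim[_]; apply.
have lt_k1n : k.-1 < n by lia.
pose p := Ordinal lt_k1n.
have incp (a b : 'I_n) : a < b -> b <= p -> d a < d b.
  by move=> /bim[inc _] /= le_bp; apply: inc; lia.
have [eq_kn|ne_kn] := eqVneq k n.
  by apply: (uniP p) => // a b /= le_pa lt_ab; have := ltn_ord b; lia.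
have lt_kn : k < n by rewrite ltn_neqAle ne_kn.
pose p' := Ordinal lt_kn.
have decp' (a b : 'I_n) : p' <= a -> a < b -> d b < d a.
  by move=> /= le_pa /bim[_]; apply.
case: (ltngtP (d p) (d p')) => [lt|lt|/val_inj/perm_inj/(congr1 val) /=]; last by lia.
  apply: (uniP p') => // a b lt_ab; rewrite leq_eqVlt => /predU1P[/val_inj eb|lt_bp].
    have : a <= p by move: lt_ab; rewrite eb /=; lia.
    rewrite eb leq_eqVlt => /predU1P[/val_inj -> //|lt_ap].
    exact: ltn_trans (incp _ _ lt_ap (leqnn _)) lt.
  by apply: incp => //=; move: lt_bp => /=; lia.
apply: (uniP p) => // a b; rewrite leq_eqVlt => /predU1P[/val_inj ea|lt_pa] lt_ab.
  have : p' <= b by move: lt_ab; rewrite -ea /=; lia.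
  rewrite -ea leq_eqVlt => /predU1P[/val_inj <- //|lt_pb].
  exact: ltn_trans (decp' _ _ (leqnn _) lt_pb) lt.
by apply: decp' => //; move: lt_pa => /=; lia.
Qed.

(** * Profiles of fiber sizes and their linear independence *)

Notation some_perm := {n : nat & 'S_n}.

(** The bound q is shared by all permutations compared, so that their codes live under one tent
    map. *)
Definition profile q (x : some_perm) (eps : bool) (v : nat) :=
  #|[set i | code q (tagged x) (mark (tagged x) eps) i == v]|.

Section Profile.
Variables (q : nat) (x : some_perm) (eps : bool).
Hypotheses (uni : unimodal (tagged x)) (le_xq : tag x <= q).

Lemma mark_coding :
  coding (scale q) (tagged x) (mark (tagged x) eps) (code q (tagged x) (mark (tagged x) eps)).
Proof. exact: code_coding. Qed.

Lemma mark_code_lt i : code q (tagged x) (mark (tagged x) eps) i < (scale q).*2.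
Proof. by have [] := mark_coding i. Qed.

Lemma profile_tent v : v < (scale q).*2 ->
  profile q x eps (tent (scale q) v) = profile q x eps v.
Proof. by move=> lt_v; rewrite /profile (card_fiber_tent mark_coding). Qed.

Lemma sum_profile : \sum_(v < (scale q).*2) profile q x eps v = tag x.
Proof.
rewrite /profile -(card_fiber_lt xpredT mark_code_lt) -[RHS]card_ord.
by apply: eq_card => i; rewrite !inE.
Qed.

Lemma profile_out v : (scale q).*2 <= v -> profile q x eps v = 0.
Proof.
move=> le_v; apply: eq_card0 => i; rewrite inE; apply/negbTE/eqP => ev.
by have := mark_code_lt i; rewrite ev ltnNge le_v.
Qed.

End Profile.

(** The fiber sizes sum to the degree; they then determine the permutation and its cut, whose parity
    is eps. *)
Lemma profile_inj q x y eps eps' : unimodal (tagged x) -> unimodal (tagged y) ->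
    tag x <= q -> tag y <= q -> profile q x eps =1 profile q y eps' ->
  x = y /\ eps = eps'.
Proof.
move=> uni_x uni_y le_x le_y eqp.
have : tag x = tag y.
  rewrite -(sum_profile eps le_x) -(sum_profile eps' le_y).
  by apply: eq_bigr => v _; apply: eqp.
case: x y uni_x uni_y le_x le_y eqp => [n d] [n' d'] /= uni_x uni_y le_x le_y eqp eq_n.
case: _ / eq_n d' uni_y le_y eqp => d' uni_y le_y eqp.
have [le_k bim <-] := unimodal_mark eps uni_x.
have [le_k' bim' <-] := unimodal_mark eps' uni_y.
by have [-> ->] := fiber_count_inj le_k le_k' bim bim' (code_coding _ _ le_x) (code_coding _ _ le_y) eqp.
Qed.

Section CyclicProfile.
Variables (q : nat) (c c' : cyclicDelta).
Hypotheses (le_cq : tag (val c) <= q) (le_cq' : tag (val c') <= q).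

Lemma profile_gt0P x eps v :
  reflect (exists i, code q (tagged x) (mark (tagged x) eps) i = v) (0 < profile q x eps v).
Proof.
apply: (iffP card_gt0P) => [[i]|[i <-]]; last by exists i; rewrite inE.
by rewrite inE => /eqP <-; exists i.
Qed.

Lemma cyclic_profile_exists eps : exists v, 0 < profile q (val c) eps v.
Proof.
have /andP[_ /transitive_permP[n_gt0 _]] := valP c.
eexists; apply/profile_gt0P; exists (Ordinal n_gt0); reflexivity.
Qed.

(** Contrapositively, distinct shapes cut with the same parity have disjoint supports, which
    isolates single terms in sums of profiles. *)
Lemma cyclic_profile_inj eps v :
  0 < profile q (val c) eps v -> 0 < profile q (val c') eps v -> c = c'.
Proof.
case/profile_gt0P=> i ei /profile_gt0P[i' ei']; apply: val_inj.
have /andP[uni tr] := valP c; have /andP[uni' tr'] := valP c'.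
have [le_k bim eodd] := unimodal_mark eps uni.
have [le_k' bim' eodd'] := unimodal_mark eps uni'.
have := cyclic_fiber_eq le_k le_k' tr tr' bim bim' (code_coding _ _ le_cq) (code_coding _ _ le_cq').
rewrite eodd eodd' => /(_ i i' erefl); rewrite ei ei' => /(_ erefl).
by case: (val c) => ? ?; case: (val c').
Qed.

Lemma odd_cyclic_profile v : 0 < profile q (val c) true v -> profile q (val c) true v = 1.
Proof.
have /andP[uni tr] := valP c; have [le_k bim eodd] := unimodal_mark true uni.
case/profile_gt0P=> i <-; apply/eqP/cards1P; exists i; apply/setP => j; rewrite !inE.
apply/eqP/eqP => [|-> //].
by apply: (odd_fiber_inj le_k tr bim (code_coding _ _ le_cq)); rewrite eodd.
Qed.

Lemma even_cyclic_profile v :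
  0 < profile q (val c) true v -> ~~ odd (profile q (val c') false v).
Proof.
case: (posnP (profile q (val c') false v)) => [-> //|].
case/profile_gt0P=> i' ei' /profile_gt0P[i ei].
have /andP[uni tr] := valP c; have /andP[uni' tr'] := valP c'.
have [le_k bim eodd] := unimodal_mark true uni.
have [le_k' bim' eodd'] := unimodal_mark false uni'.
have := even_cyclic_fiber le_k le_k' tr tr' bim (code_coding _ _ le_cq) (code_coding _ _ le_cq').
by rewrite eodd eodd' => /(_ i i' isT isT); rewrite ei ei' => /(_ erefl).
Qed.

End CyclicProfile.

(** The fiber sizes expected from [a c] copies of each c cut evenly and [b c] copies cut oddly. *)
Definition weighted_profile q (s : seq cyclicDelta) (a b : cyclicDelta -> nat) v :=
  \sum_(c <- s) (a c * profile q (val c) false v + b c * profile q (val c) true v).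

Lemma weighted_profile_inj q s (a a' : cyclicDelta -> nat) (b b' : cyclicDelta -> bool) :
    uniq s -> (forall c, c \in s -> tag (val c) <= q) ->
    weighted_profile q s a b =1 weighted_profile q s a' b' ->
  forall c, c \in s -> a c = a' c /\ b c = b' c.
Proof.
move=> Us le_q eqw.
(* At a code of c cut oddly, c contributes 1 for its odd cut, all even-cut profiles are even, and
   the other odd-cut ones vanish. *)
have oddE (a1 : cyclicDelta -> nat) (b1 : cyclicDelta -> bool) c v : c \in s ->
    0 < profile q (val c) true v -> odd (weighted_profile q s a1 b1 v) = b1 c.
  move=> cs pc; rewrite /weighted_profile (bigD1_seq c) //= !oddD !oddM.
  rewrite (negPf (even_cyclic_profile (le_q _ cs) (le_q _ cs) pc)).
  rewrite (odd_cyclic_profile (le_q _ cs) pc) andbF andbT oddb /=.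
  rewrite big_seq_cond; set X := \sum_(_ <- _ | _) _.
  suff /negPf -> : ~~ odd X by rewrite addbF.
  apply: (big_ind (fun x => ~~ odd x)) => // [x y|c1 /andP[c1s ne_c]]; first by rewrite oddD => /negPf -> /negPf ->.
  rewrite oddD oddM (negPf (even_cyclic_profile (le_q _ cs) (le_q _ c1s) pc)) andbF /=.
  case: (posnP (profile q (val c1) true v)) => [->|pc1]; first by rewrite muln0.
  by rewrite (cyclic_profile_inj (le_q _ c1s) (le_q _ cs) pc1 pc) eqxx in ne_c.
have eqb c : c \in s -> b c = b' c.
  move=> cs; have [v pc] := cyclic_profile_exists q c true.
  by rewrite -(oddE a b c v) // -(oddE a' b' c v) // eqw.
move=> c cs; split; last exact: eqb.
have [v pc] := cyclic_profile_exists q c false.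
(* At a code of c cut evenly no other even-cut profile contributes; the odd-cut parts already agree
   and cancel. *)
have evenE (a1 : cyclicDelta -> nat) : \sum_(c1 <- s) a1 c1 * profile q (val c1) false v =
    a1 c * profile q (val c) false v.
  rewrite (bigD1_seq c) //= big_seq_cond big1 ?addn0 // => c1 /andP[c1s ne_c].
  case: (posnP (profile q (val c1) false v)) => [->|pc1]; first by rewrite muln0.
  by rewrite (cyclic_profile_inj (le_q _ c1s) (le_q _ cs) pc1 pc) eqxx in ne_c.
move: (eqw v); rewrite /weighted_profile !big_split /= !evenE.
have -> : \sum_(c <- s) b' c * profile q (val c) true v =
    \sum_(c <- s) b c * profile q (val c) true v.
  by apply: eq_big_seq => c1 /eqb ->.
by move/addIn/eqP; rewrite eqn_pmul2r // => /eqP.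
Qed.

(** * Decomposition of a profile over the cycles *)

Definition tagged_shape n (d : 'S_n) (J : {set 'I_n}) : some_perm :=
  Tagged (fun n : nat => 'S_n) (cycle_shape d J).

Definition odd_cycle n (d : 'S_n) eps (J : {set 'I_n}) := odd (#|J| - cut (mark d eps) J).

Lemma shape_cyclic n (d : 'S_n) (J : {set 'I_n}) : unimodal d -> J \in porbits d ->
  exists c : cyclicDelta, val c = tagged_shape d J.
Proof.
move=> uni Jd; have [_ bim _] := unimodal_mark false uni.
have tr := shape_transitive Jd.
have ushape : unimodal (tagged (tagged_shape d J)).
  apply: bimonotone_unimodal (cut_le _ _) (shape_bimonotone Jd bim).
  by have /transitive_permP[] := tr.
have both : unimodal (tagged (tagged_shape d J)) && transitive_perm (tagged (tagged_shape d J)).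
  by rewrite ushape.
by exists (exist _ (tagged_shape d J) both).
Qed.

(** By uniqueness of codings, the code of the shape is the code of d restricted to J. *)
Lemma shape_profile q n (d : 'S_n) (J : {set 'I_n}) eps v :
    n <= q -> unimodal d -> J \in porbits d ->
  profile q (tagged_shape d J) (odd_cycle d eps J) v =
  #|[set i in J | code q d (mark d eps) i == v]|.
Proof.
move=> le_nq uni Jd; have [_ bim _] := unimodal_mark eps uni.
rewrite /profile /= /odd_cycle mark_unique ?cut_le ?shape_bimonotone //.
have le_Jq : #|J| <= q by rewrite (leq_trans _ le_nq) // -[leqRHS]card_ord max_card.
have codeE := coding_unique (code_coding _ _ le_Jq)
  (shape_coding Jd (code_coding d (mark d eps) le_nq)).
rewrite -(card_imset _ (@enum_val_inj _ _)); apply: eq_card => x; rewrite inE.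
apply/imsetP/andP => [[i]|[xJ /eqP ex]].
  by rewrite inE codeE => /eqP <- ->; rewrite enum_valP.
by exists (enum_rank_in xJ x); rewrite ?inE ?codeE /= enum_rankK_in // ex.
Qed.

(** Equal shapes cut with the same parity share a code, giving x in J and y in J' in one fiber. Both
    return after #|J| steps, which reverse order, so x = y. *)
Lemma odd_cycle_unique n (d : 'S_n) eps J J' : unimodal d ->
    J \in porbits d -> J' \in porbits d -> odd_cycle d eps J -> odd_cycle d eps J' ->
  tagged_shape d J = tagged_shape d J' -> J = J'.
Proof.
move=> uni Jd J'd oJ oJ' eq_sh; have [_ bim _] := unimodal_mark eps uni.
have cod := code_coding d (mark d eps) (leqnn n).
have [c ec] := shape_cyclic uni Jd.
have [v pc] := cyclic_profile_exists n c true.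
move: (pc); rewrite ec -oJ shape_profile // => /card_gt0P[x].
move: (pc); rewrite ec eq_sh -oJ' shape_profile // => /card_gt0P[y].
rewrite !inE => /andP[yJ' /eqP ey] /andP[xJ /eqP ex].
have orbE z K : K \in porbits d -> z \in K -> porbit d z = K.
  by case/imsetP=> w _ ->; rewrite -eq_porbit_mem => /eqP.
have eJ := orbE _ _ Jd xJ; have eJ' := orbE _ _ J'd yJ'.
have sz : #|J| = #|J'| by have := congr1 tag eq_sh.
suff exy : x = y by rewrite -eJ -eJ' exy.
apply: (odd_return_unique bim cod (t := #|J|)); rewrite ?ex ?ey //.
- have [bimJ codJ] := (shape_bimonotone Jd bim, shape_coding Jd cod).
  have := vpar_transitive (cut_le _ _) (shape_transitive Jd) codJ (enum_rank_in xJ x).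
  by rewrite /= enum_rankK_in // ex => ->.
- by rewrite -eJ iter_porbit.
by rewrite sz -eJ' iter_porbit.
Qed.

Lemma counter_support (d : Delta) :
  exists2 s : seq cyclicDelta, forall c, cycle_counter d c != 0 -> c \in s &
    forall c, c \in s -> tag (val c) <= tag (val d).
Proof.
exists (pmap insub [seq tagged_shape (tagged (val d)) J | J <- enum (porbits (tagged (val d)))]) => c.
  rewrite -lt0n => /card_gt0P[J]; rewrite inE => /andP[Jd /eqP eJ].
  by rewrite mem_pmap_sub -eJ; apply/mapP; exists J; rewrite ?mem_enum.
rewrite mem_pmap_sub => /mapP[J _ ->] /=.
by rewrite -[leqRHS]card_ord max_card.
Qed.

(** Here [b c] tells whether a cycle of shape c is cut oddly; by [odd_cycle_unique] there is at most
    one. *)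
Lemma profile_decomposition q (d : Delta) eps : tag (val d) <= q ->
  exists2 b : cyclicDelta -> bool, forall c, b c <= cycle_counter d c &
    forall s, uniq s -> (forall c, cycle_counter d c != 0 -> c \in s) ->
    profile q (val d) eps =1 weighted_profile q s (fun c => cycle_counter d c - b c) b.
Proof.
case: d => -[n d] /= uni le_nq.
pose cycles (c : cyclicDelta) := [set J in porbits d | tagged_shape d J == val c].
pose odds (c : cyclicDelta) := [set J in cycles c | odd_cycle d eps J].
have odds_sub (c : cyclicDelta) : #|odds c| <= #|cycles c|.
  by apply/subset_leq_card/subsetP => J; rewrite inE => /andP[].
have odds_le1 (c : cyclicDelta) : #|odds c| <= 1.
  apply/card_le1P => J; rewrite !inE => /andP[/andP[Jd /eqP eJ] oJ] J'; rewrite !inE.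
  apply/andP/eqP => [[/andP[J'd /eqP eJ'] oJ']|->]; last by rewrite Jd eJ eqxx.
  by apply: (odd_cycle_unique uni J'd Jd oJ' oJ); rewrite eJ'.
pose b (c : cyclicDelta) := odds c != set0.
have cardE (c : cyclicDelta) : #|odds c| = b c.
  by rewrite /b -card_gt0; case: #|_| (odds_le1 c) => [|[]].
exists b => [c|s Us all_s v]; first by rewrite -cardE.
have orbE z K : K \in porbits d -> (porbit d z == K) = (z \in K).
  by case/imsetP=> w _ ->; rewrite eq_porbit_mem.
(* Each fiber splits over the cycles; these are then grouped by shape. *)
transitivity (\sum_(J in porbits d) profile q (tagged_shape d J) (odd_cycle d eps J) v).
  rewrite /profile -sum1dep_card.
  rewrite (partition_big (porbit d) (mem (porbits d))) => [|i _]; last exact: imset_f.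
  apply: eq_bigr => J Jd; rewrite -[RHS]/(profile q (tagged_shape d J) (odd_cycle d eps J) v).
  rewrite shape_profile // -sum1dep_card; apply: eq_bigl => i.
  by rewrite orbE // andbC.
transitivity (\sum_(J in porbits d) \sum_(c <- s | tagged_shape d J == val c)
    profile q (val c) (odd_cycle d eps J) v).
  apply: eq_bigr => J Jd; have [c0 ec0] := shape_cyclic uni Jd.
  have c0s : c0 \in s.
    apply: all_s; rewrite -lt0n; apply/card_gt0P; exists J; rewrite inE Jd /=.
    by apply/eqP; rewrite ec0.
  rewrite -ec0; under eq_bigl => c do rewrite (inj_eq val_inj) eq_sym.
  by rewrite -big_filter filter_pred1_uniq // big_seq1.
rewrite (exchange_big_dep xpredT) //=; apply: eq_bigr => c _.
rewrite (bigID (odd_cycle d eps)) /= addnC; congr (_ + _).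
  rewrite -[cycle_counter _ _]/#|cycles c| -cardE.
  have -> : #|cycles c| - #|odds c| = #|cycles c :\: odds c|.
    rewrite cardsD (setIidPr _) //; apply/subsetP => J; by rewrite inE => /andP[].
  rewrite -sum_nat_const; apply: eq_big => [J|J]; first by rewrite !inE; case: (J \in porbits d); case: (tagged_shape d J == val c); case: odd_cycle.
  by case/andP => _ /negPf ->.
rewrite -cardE -sum_nat_const; apply: eq_big => [J|J]; first by rewrite !inE.
by case/andP => _ ->.
Qed.

Lemma sum_weighted_profile q s (a b : cyclicDelta -> nat) :
    (forall c, c \in s -> tag (val c) <= q) ->
  \sum_(v < (scale q).*2) weighted_profile q s a b v =
  \sum_(c <- s) (a c + b c) * tag (val c).
Proof.
move=> le_q; rewrite exchange_big /=; apply: eq_big_seq => c /le_q le_c.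
by rewrite big_split -!big_distrr /= !sum_profile // mulnDl.
Qed.

Lemma weighted_profile_widen q s s' a b : uniq s -> uniq s' -> {subset s <= s'} ->
    (forall c, c \notin s -> a c = 0 /\ b c = 0) ->
  weighted_profile q s a b =1 weighted_profile q s' a b.
Proof.
move=> Us Us' sub0 out v; rewrite /weighted_profile [RHS](bigID (mem s)) /=.
rewrite [X in _ + X]big1 ?addn0 => [|c /out[-> ->] //].
rewrite -[RHS]big_filter; apply/perm_big/uniq_perm; rewrite ?filter_uniq // => c.
by rewrite mem_filter /= andb_idr //; apply: sub0.
Qed.

(** Sum the decomposition of the profile over all codes, with q bounding the degrees of d and of
    every shape in s. *)
Lemma sum_counter (d : Delta) s : uniq s ->
    (forall c, cycle_counter d c != 0 -> c \in s) ->
  tag (val d) = \sum_(c <- s) cycle_counter d c * tag (val c).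
Proof.
move=> Us all_s; pose q := tag (val d) + \sum_(c <- s) tag (val c).
have le_dq : tag (val d) <= q by apply: leq_addr.
have le_q c : c \in s -> tag (val c) <= q.
  by move=> cs; rewrite /q (bigD1_seq c) //= addnCA leq_addr.
have [b le_b /(_ s Us all_s) eqp] := profile_decomposition false le_dq.
rewrite -(sum_profile false le_dq) (eq_bigr _ (fun (v : 'I__) _ => eqp v)).
rewrite sum_weighted_profile //; apply: eq_bigr => c _.
by rewrite subnK.
Qed.

(** * Counting permutations with a given cycle counter *)

Local Open Scope fset_scope.

Section Counting.
Variable N : {fsfun cyclicDelta -> nat with 0}.

(** By [sum_counter], the degree of every permutation with counter N; it also bounds the degrees of
    the shapes in the support. *)
Let q := \sum_(c <- finsupp N) N c * tag (val c).

(** S is the set of shapes having one copy cut oddly. *)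
Definition choice_profile (S : {fset cyclicDelta}) :=
  weighted_profile q (finsupp N) (fun c => N c - (c \in S)) (fun c => c \in S).

(** This becomes a bijection between the subsets of the support and the pairs of a permutation with
    counter N and a parity. *)
Definition realizes (S : {fset cyclicDelta}) (x : Delta * bool) :=
  tag (val x.1) = q /\ profile q (val x.1) x.2 =1 choice_profile S.

Lemma supp_size c : c \in finsupp N -> tag (val c) <= q.
Proof.
move=> cN; rewrite /q (bigD1_seq c) ?fset_uniq //=; move: cN; rewrite mem_finsupp -lt0n => N_gt0.
exact: leq_trans (leq_pmull _ N_gt0) (leq_addr _ _).
Qed.

Lemma choice_le S c : S `<=` finsupp N -> (c \in S) <= N c.
Proof.
by move=> /fsubsetP sub; case: (boolP (c \in S)) => [/sub|//]; rewrite mem_finsupp lt0n.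
Qed.

Lemma realizes_inj S x y : realizes S x -> realizes S y -> x = y.
Proof.
case: x y => [d e] [d' e'] [/= sz eqp] [/= sz' eqp'].
have [||||v|/val_inj -> -> //] := @profile_inj q (val d) (val d') e e'.
- exact: (valP d).
- exact: (valP d').
- by rewrite sz.
- by rewrite sz'.
by rewrite eqp eqp'.
Qed.

Lemma realizes_inj_choice S S' x : S `<=` finsupp N -> S' `<=` finsupp N ->
  realizes S x -> realizes S' x -> S = S'.
Proof.
move=> sub sub' [_ eqp] [_ eqp'].
have eqw v : choice_profile S v = choice_profile S' v by rewrite -eqp -eqp'.
have inj := weighted_profile_inj (fset_uniq _) supp_size eqw.
apply/fsetP => c; have [/inj[] //|cN] := boolP (c \in finsupp N).
by rewrite (negPf (contra (fsubsetP sub c) cN)) (negPf (contra (fsubsetP sub' c) cN)).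
Qed.

Lemma counter_realizes d eps : (forall c, cycle_counter d c = N c) ->
  exists2 S, S `<=` finsupp N & realizes S (d, eps).
Proof.
move=> eqN; have all_s c : cycle_counter d c != 0 -> c \in finsupp N.
  by rewrite eqN mem_finsupp.
have sz : tag (val d) = q.
  by rewrite (sum_counter (fset_uniq _) all_s); apply: eq_bigr => c _; rewrite eqN.
have [b le_b /(_ _ (fset_uniq _) all_s) eqp] := profile_decomposition eps (eq_leq sz).
exists [fset c in finsupp N | b c].
  by apply/fsubsetP => c; rewrite !inE => /andP[].
split=> // v; rewrite eqp; apply: eq_big_seq => c cN.
by rewrite !inE /= cN eqN.
Qed.

(** The chosen profile is tent-invariant, so [fiber_count_surj] realizes it. Comparing it with the
    decomposition of the resulting permutation identifies the counter, by independence of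
    profiles. *)
Lemma realizable S : S `<=` finsupp N -> 0 < q ->
  exists2 x, realizes S x & forall c, cycle_counter x.1 c = N c.
Proof.
move=> sub q_gt0.
have uniC (c : cyclicDelta) : unimodal (tagged (val c)) by have /andP[] := valP c.
have inv v : v < (scale q).*2 -> choice_profile S (tent (scale q) v) = choice_profile S v.
  move=> lt_v; apply: eq_big_seq => c cN.
  by rewrite !profile_tent ?supp_size.
have [n [d [k [H [le_kn bim cod cardH]]]]] := fiber_count_surj inv.
have ltH i : H i < (scale q).*2 by have [] := cod i.
have eq_n : n = q.
  transitivity #|[set i | xpredT (H i)]|.
    by rewrite -[LHS]card_ord; apply: eq_card => i; rewrite !inE.
  rewrite (card_fiber_lt xpredT ltH) (eq_bigr _ (fun (v : 'I__) _ => cardH v (ltn_ord v))).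
  rewrite sum_weighted_profile; last exact: supp_size.
  by apply: eq_bigr => c _; rewrite subnK // choice_le.
have uni : unimodal d by apply: bimonotone_unimodal le_kn bim; rewrite eq_n.
pose x : Delta := exist _ (Tagged (fun n => 'S_n) d) uni.
have le_nq : n <= q by rewrite eq_n.
have real : realizes S (x, odd (n - k)).
  split=> //= v; rewrite /profile /= mark_unique //.
  have codeE := coding_unique (code_coding d k le_nq) cod.
  have -> : #|[set i | code q d k i == v]| = #|[set i | H i == v]|.
    by apply: eq_card => i; rewrite !inE codeE.
  case: (ltnP v (scale q).*2) => [/cardH //|le_v].
  rewrite eq_card0 => [|i]; last by rewrite inE; apply/negbTE/eqP; have := ltH i; lia.
  rewrite /choice_profile /weighted_profile big_seq big1 // => c cN.
  by rewrite !profile_out ?muln0 ?supp_size.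
exists (x, odd (n - k)) => // c.
have [s1 all_s1 le_s1] := counter_support x.
(* Both counters vanish off s, so the two decompositions can be compared there. *)
pose s := undup (finsupp N ++ s1).
have mem_s c0 : (c0 \in s) = (c0 \in finsupp N) || (c0 \in s1).
  by rewrite mem_undup mem_cat.
have Us : uniq s := undup_uniq _.
have all_s c0 : cycle_counter x c0 != 0 -> c0 \in s by rewrite mem_s orbC => /all_s1 ->.
have le_s c0 : c0 \in s -> tag (val c0) <= q.
  by rewrite mem_s => /orP[/supp_size //|/le_s1/leq_trans -> //].
have [b le_b /(_ s Us all_s) eqp] := profile_decomposition (odd (n - k)) (le_nq : tag (val x) <= q).
have eqw : weighted_profile q s (fun c => cycle_counter x c - b c) b =1
           weighted_profile q s (fun c => N c - (c \in S)) (fun c => c \in S).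
  move=> v; rewrite -eqp real.2; apply: weighted_profile_widen; rewrite ?fset_uniq //.
    by move=> c0; rewrite mem_s => ->.
  move=> c0 c0N; rewrite (negPf (contra (fsubsetP sub c0) c0N)); split=> //.
  by rewrite fsfun_dflt.
have inj := weighted_profile_inj Us le_s eqw.
have [/inj[eqa eqb]|cs] := boolP (c \in s).
  by rewrite -(subnK (le_b c)) -(subnK (choice_le c sub)) eqa eqb.
have := contra (all_s c) cs; rewrite negbK => /eqP ->.
by move: cs; rewrite mem_s negb_or => /andP[cN _]; rewrite fsfun_dflt.
Qed.

End Counting.

Theorem mainTheorem1 (N : {fsfun cyclicDelta -> nat with 0}) :
  (exists c : cyclicDelta, N c <> 0) ->
  exists D : {fset Delta},
    (forall d : Delta, d \in D <-> (forall c : cyclicDelta, cycle_counter d c = N c))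
    /\ #|` D| = 2 ^ (#|` finsupp N| - 1).
Proof.
case=> c0 /eqP c0N; have c0s : c0 \in finsupp N by rewrite mem_finsupp.
have q_gt0 : 0 < \sum_(c <- finsupp N) N c * tag (val c).
  rewrite (bigD1_seq c0) ?fset_uniq //= addn_gt0 muln_gt0 lt0n c0N.
  by have /andP[_ /transitive_permP[n_gt0 _]] := valP c0; rewrite n_gt0.
pose P := fpowerset (finsupp N).
have subP (S : P) : val S `<=` finsupp N by rewrite -fpowersetE (valP S).
have /fin_all_exists2[f real_f counter_f] (S : P) := realizable (subP S) q_gt0.
have f_inj : injective f.
  move=> S S' eqf; apply/val_inj/(realizes_inj_choice (subP S) (subP S') (real_f S)).
  by rewrite eqf.
have f_surj d eps : (forall c, cycle_counter d c = N c) -> exists S, f S = (d, eps).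
  move=> /(counter_realizes eps)[S subS realS].
  have SP : S \in P by rewrite fpowersetE.
  by exists [` SP]; apply: (realizes_inj (real_f [` SP])).
pose D := [fset (f S).1 | S : P].
have memD d : d \in D <-> (forall c, cycle_counter d c = N c).
  split=> [/imfsetP[S _ ->]|/(f_surj _ false)[S eS]]; first exact: counter_f.
  by apply/imfsetP; exists S; rewrite ?eS.
exists D; split=> //.
(* Each member of D occurs with both parities, so twice the size of D is the number of subsets of
   the support. *)
have eq_im : perm_eq [seq f T | T <- enum {: P}] [seq (d, eps) | d <- D, eps <- [:: false; true]].
  apply: uniq_perm; first by rewrite map_inj_uniq ?enum_uniq.
    by apply: allpairs_uniq => // -[? ?] [? ?].
  move=> [d eps]; apply/mapP/allpairsP => [[S _ eS]|[[d' eps'] /= [/memD dD _ [-> ->]]]].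
    exists (d, eps); split=> //=; last by case: eps {eS}.
    by apply/imfsetP; exists S; rewrite // -eS.
  by have [S <-] := f_surj _ eps' dD; exists S; rewrite ?mem_enum.
have := perm_size eq_im.
rewrite size_map -cardE size_allpairs -cardfE card_fpowerset.
have supp_gt0 : 0 < #|` finsupp N| by rewrite cardfs_gt0; apply/fset0Pn; exists c0.
rewrite -{1}(subnK supp_gt0) addn1 expnSr => /eqP; rewrite eqn_pmul2r // => /eqP ->.
by [].
Qed.
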